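(* Let $\alpha\in\mathbb{Q}(i,\sqrt3)$ be an ambiguous number and let $\Gamma\alpha$ be its orbit under the Picard group $\Gamma=PSL(2,\mathbb{Z}[i])$. Then in $\Gamma\alpha$ there is only one closed path of ambiguous numbers.
   Context: The Picard group $\Gamma=PSL(2,\mathbb{Z}[i])$ acts on $\mathbb{Q}(i,\sqrt3)\cup\{\infty\}$ by linear fractional transformations $z\mapsto\frac{pz+q}{rz+s}$ with $p,q,r,s\in\mathbb{Z}[i]$, $ps-qr=1$. It is generated by $A(z)=\frac{1}{z-i}$, $B(z)=\frac1z$, $C(z)=\frac{1+z}{-z}$, $D(z)=\frac{-1}{z}$, with defining relations $A^3=B^2=C^3=D^2=(AC)^2=(AD)^2=(BC)^2=(BD)^2=1$. An ambiguous number is a real quadratic irrational number $\alpha=\frac{a+b\sqrt3}{c}\in\mathbb{Q}(i,\sqrt3)$ with $a,b,c\in\mathbb{Z}$, $c\neq0$, such that $\alpha$ and its conjugate $\bar\alpha=\frac{a-b\sqrt3}{c}$ have opposite signs. A closed path of ambiguous numbers (in the coset diagram of the orbit, i.e. the graph on $\Gamma\alpha$ whose edges are given by the generators) is a pair of circuits of ambiguous numbers joined by $B$-edges. Precisely, it is a set $P\subseteq\Gamma\alpha$ of the form $P=\{\beta_0,\dots,\beta_{2n-1}\}\cup\{B(\beta_0),\dots,B(\beta_{2n-1})\}$, with $n\ge1$, where $\beta_0,\dots,\beta_{2n-1}$ are pairwise distinct ambiguous numbers such that (indices modulo $2n$) $\beta_{2j+1}\in\{C(\beta_{2j}),C^2(\beta_{2j})\}$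 and $\beta_{2j+2}=D(\beta_{2j+1})$ for all $j$. Two closed paths are the same if they are equal as sets. *)

(* Defs.v *)
From mathcomp Require Import all_boot all_order all_algebra all_field.
From mathcomp Require Import classical_sets.

Set Implicit Arguments.
Unset Strict Implicit.
Unset Printing Implicit Defensive.

Import Order.TTheory GRing.Theory Num.Theory.
Local Open Scope classical_set_scope.
Local Open Scope ring_scope.

Definition sqrt3 : algC := sqrtC 3.

Definition in_Qi3 (x : algC) : Prop :=
  exists a b c d : rat,
    x = ratr a + ratr b * 'i + ratr c * sqrt3 + ratr d * ('i * sqrt3).

Definition gauss_int (x : algC) : Prop :=
  exists m n : int, x = m%:~R + n%:~R * 'i.

(* The projective line over [algC], with [None] the point at infinity. The
   orbit of a point of Q(i, sqrt 3) stays in Q(i, sqrt 3) with infinity added,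
   so working over [algC] does not change any orbit considered below. *)
Definition P1 : Type := option algC.

Definition moebius (p q r s : algC) (z : P1) : P1 :=
  match z with
  | Some x =>
      if r * x + s == 0 then None else Some ((p * x + q) / (r * x + s))
  | None => if r == 0 then None else Some (p / r)
  end.

(* Orbit under PSL(2, Z[i]): a matrix and its opposite induce the same
   transformation, so it is enough to range over SL(2, Z[i]). *)
Definition picard_orbit (z : P1) : set P1 :=
  [set w | exists p q r s : algC,
     [/\ gauss_int p /\ gauss_int q, gauss_int r /\ gauss_int s,
         p * s - q * r = 1 & w = moebius p q r s z]].

(* z |-> 1 / z; the determinant here is -1, but the same transformation is
   given by the matrix (0, i; i, 0) of SL(2, Z[i]). *)
Definition genB : P1 -> P1 := moebius 0 1 1 0.

(* z |-> (1 + z) / (- z) *)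
Definition genC : P1 -> P1 := moebius 1 1 (-1) 0.

(* z |-> -1 / z *)
Definition genD : P1 -> P1 := moebius 0 (-1) 1 0.

(* [x] and [x'] below are real, so the partial order of [algC] compares them
   with 0. As the conjugate x' is determined by x, the choice of the
   representation (a, b, c) is immaterial. *)
Definition ambiguous (x : algC) : Prop :=
  x \notin Crat /\
  exists a b c : int,
    let x' := (a%:~R - b%:~R * sqrt3) / c%:~R in
    [/\ c != 0, x = (a%:~R + b%:~R * sqrt3) / c%:~R
      & (0 < x /\ x' < 0) \/ (x < 0 /\ 0 < x')].

(* beta_0, ..., beta_(2n-1) are the values of [beta] below [n.*2]; its other
   values are irrelevant. *)
Definition circuit (n : nat) (beta : nat -> algC) : Prop :=
  [/\ (0 < n)%N,
      forall i, (i < n.*2)%N -> ambiguous (beta i),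
      forall i j, (i < n.*2)%N -> (j < n.*2)%N -> beta i = beta j -> i = j,
      forall j, (j < n)%N ->
        Some (beta j.*2.+1) = genC (Some (beta j.*2)) \/
        Some (beta j.*2.+1) = genC (genC (Some (beta j.*2)))
    & forall j, (j < n)%N ->
        Some (beta (j.*2.+2 %% n.*2)%N) = genD (Some (beta j.*2.+1))].

Definition closed_path (alpha : algC) (P : set P1) : Prop :=
  P `<=` picard_orbit (Some alpha) /\
  exists n beta, circuit n beta /\
    P = [set Some (beta i) | i in `I_(n.*2)] `|`
        [set genB (Some (beta i)) | i in `I_(n.*2)].

(* Main.v *)
Require Import Defs.
From mathcomp Require Import all_boot all_order all_algebra all_field.
From mathcomp Require Import classical_sets.
From mathcomp Require Import ring zify.

(** Every closed path is shown to be the set of all ambiguous numbers of the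
    orbit (lemma [closed_pathE]), so that two of them are equal; the existence
    of one is [closed_path_exists].

    First, the Picard group restricts to PGL(2, Z) on ambiguous numbers. Let X
    + iY be a matrix of SL(2, Z[i]) that maps one real quadratic irrational to
    another. Comparing real and imaginary parts, and then applying the Galois
    conjugation of Q(sqrt 3), gives det X * det Y <= 0. Together with det X -
    det Y = 1 this leaves det X = 1 or det Y = -1, and then the integer matrix
    X, or Y, already induces the same map at that point ([picard_gl2]).

    Next, call x positive ambiguous when x > 0 > x', with x' its conjugate.
    Exactly one of x + 1 and x / (x + 1) is positive ambiguous again, because
    x' <> -1; this is the Farey step from x. From a positive ambiguous number,
    a C-edge and then a D-edge of the coset diagram make a Farey step, a
    D-edge and then a C-edge undo one ([on_circuit_step]), so that a circuit
    is closed under Farey steps and their inverses. If g in SL(2, Z) maps a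
    positive ambiguous number to another one, then the quadratic polynomial (p
    x + q)(r x + s) is positive at x and negative at x', and the signs of its
    coefficients force g or its inverse to have entries of constant sign.
    Geometrically, the geodesic from x' to x crosses the Farey edges g(0, oo)
    in a definite order. A matrix with natural entries and determinant 1 is a
    product of the matrices of the two Farey steps, by subtracting one row
    from the other. Hence a circuit contains all the positive ambiguous
    numbers of its SL(2, Z)-orbit ([sl2_invariant]); applying B, whose
    determinant is -1, and D, which changes the sign, accounts for the others
    ([on_path_full]).

    For the existence, a positive ambiguous number is the larger root of an
    integral form a X^2 + b X + c with a > 0 > c and discriminant 3 m^2. A
    Farey step induces an injective map on these forms that preserves m, and
    for a given m there are finitely many of them; thus the Farey steps from
    any positive ambiguous number are periodic, and one minimal period gives a
    circuit ([pos_circuit]). *)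

Set Implicit Arguments.
Unset Strict Implicit.
Unset Printing Implicit Defensive.

Import Order.TTheory GRing.Theory Num.Theory.
Local Open Scope ring_scope.

(** * Galois conjugation in Q(sqrt 3) *)

Lemma sqrt3_sq : sqrt3 ^+ 2 = 3.
Proof. exact: sqrtCK. Qed.

Lemma sqrt3_gt0 : 0 < sqrt3.
Proof. by rewrite sqrtC_gt0 ltr0n. Qed.

Lemma sqrt3_real : sqrt3 \is Num.real.
Proof. exact: gtr0_real sqrt3_gt0. Qed.

(** The 3-adic valuations of the two sides would have different parities. *)
Lemma sqr_eq_3sqr_eq0 (n m : int) : n ^+ 2 = 3 * m ^+ 2 -> m = 0.
Proof.
move=> /(congr1 absz); rewrite abszM !abszX /=.
case: (posnP `|m|%N) => [/eqP|m_gt0 e]; first by rewrite absz_eq0 => /eqP.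
have n_gt0 : (0 < `|n|)%N.
  by case: (posnP `|n|%N) e => // ->; case: `|m|%N m_gt0.
move: e => /(congr1 (logn 3)); rewrite lognM ?expn_gt0 ?m_gt0 // !lognX /=.
by move=> /(congr1 odd); rewrite oddD !oddM.
Qed.

(** A relation rather than a function: it avoids choosing coordinates in
    Q(sqrt 3) for an element of [algC]. *)
Definition conj3 (x x' : algC) : Prop := exists u v : rat,
  x = ratr u + ratr v * sqrt3 /\ x' = ratr u - ratr v * sqrt3.

(** Irrationality of sqrt 3, in the form that makes conjugation well defined. *)
Lemma ratr_sqrt3_eq0 (u v : rat) :
  ratr u + ratr v * sqrt3 = 0 -> u = 0 /\ v = 0.
Proof.
move=> e; have uv : u ^+ 2 = 3 * v ^+ 2.
  apply: (fmorph_inj (ratr : rat -> algC)).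
  rewrite rmorphXn [RHS]rmorphM /= rmorphXn /= ratr_nat -sqrt3_sq -exprMn.
  by rewrite (canRL (addrK _) e) sub0r sqrrN mulrC.
have v0 : v = 0.
  apply/eqP; rewrite -numq_eq0; apply/eqP.
  have := sqr_eq_3sqr_eq0 (n := numq u * denq v) (m := numq v * denq u).
  have H : (numq u * denq v) ^+ 2 = 3 * (numq v * denq u) ^+ 2.
    apply: (intr_inj (R := rat)).
    have h : (numq u)%:~R ^+ 2 * (denq v)%:~R ^+ 2 =
             3 * ((numq v)%:~R * (denq u)%:~R) ^+ 2 :> rat.
      by rewrite !numqE exprMn uv; ring.
    transitivity ((numq u)%:~R ^+ 2 * (denq v)%:~R ^+ 2 : rat).
      by rewrite rmorphXn /= rmorphM exprMn.
    by rewrite h [RHS]rmorphM /= rmorphXn /= rmorphM.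
  by move/(_ H)/eqP; rewrite mulf_eq0 (negPf (denq_neq0 u)) orbF => /eqP.
by split=> //; move/eqP: uv; rewrite v0 expr0n mulr0 sqrf_eq0 => /eqP.
Qed.

Lemma conj3_uniq (x x1 x2 : algC) : conj3 x x1 -> conj3 x x2 -> x1 = x2.
Proof.
move=> [u [v [-> ->]]] [u2 [v2 [e ->]]].
have [] := @ratr_sqrt3_eq0 (u - u2) (v - v2).
  by rewrite !rmorphB /= mulrBl; move/eqP: e; rewrite -subr_eq0 => /eqP<-; ring.
by move=> /eqP; rewrite subr_eq0 => /eqP-> /eqP; rewrite subr_eq0 => /eqP->.
Qed.

Lemma conj3_rat (q : rat) : conj3 (ratr q) (ratr q).
Proof. by exists q, 0; rewrite raddf0 mul0r addr0 subr0. Qed.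

Lemma conj3_int (n : int) : conj3 n%:~R n%:~R.
Proof. by have := conj3_rat n%:~R; rewrite ratr_int. Qed.

Lemma conj3_1 : conj3 1 1.
Proof. exact: conj3_int 1. Qed.

Lemma conj3D (x x' y y' : algC) :
  conj3 x x' -> conj3 y y' -> conj3 (x + y) (x' + y').
Proof.
move=> [u [v [-> ->]]] [u2 [v2 [-> ->]]]; exists (u + u2), (v + v2).
by rewrite !rmorphD /=; split; ring.
Qed.

Lemma conj3M (x x' y y' : algC) :
  conj3 x x' -> conj3 y y' -> conj3 (x * y) (x' * y').
Proof.
move=> [u [v [-> ->]]] [u2 [v2 [-> ->]]].
exists (u * u2 + 3 * v * v2), (u * v2 + v * u2).
have r3 : ratr 3 = sqrt3 ^+ 2 :> algC by rewrite sqrt3_sq ratr_nat.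
by rewrite !raddfD /= !rmorphM /= r3; split; ring.
Qed.

Lemma conj3N (x x' : algC) : conj3 x x' -> conj3 (- x) (- x').
Proof.
by move=> c; rewrite -mulN1r -(mulN1r x'); apply: conj3M c; apply: (conj3_int (-1)).
Qed.

Lemma conj3V (x x' : algC) : conj3 x x' -> conj3 x^-1 x'^-1.
Proof.
move=> [u [v [ex ex']]].
have [xx0|xx0] := eqVneq (x * x') 0.
  suff [-> ->] : x = 0 /\ x' = 0.
    by rewrite invr0; apply: (conj3_int 0).
  move/eqP: xx0; rewrite mulf_eq0 => /orP[]/eqP e0.
    by have [u0 v0] := ratr_sqrt3_eq0 (etrans (esym ex) e0);
      rewrite ex ex' u0 v0 raddf0 mul0r addr0 subr0.
  have [u0 /eqP] : u = 0 /\ - v = 0.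
    by apply: ratr_sqrt3_eq0; rewrite raddfN mulNr -ex'.
  by rewrite oppr_eq0 => /eqP v0; rewrite ex ex' u0 v0 raddf0 mul0r addr0 subr0.
pose N := u ^+ 2 - 3 * v ^+ 2.
have eN : ratr N = x * x'.
  by rewrite /N ex ex' raddfB /= rmorphXn /= [ratr (3 * _)]rmorphM /= rmorphXn /=
    ratr_nat -sqrt3_sq; ring.
exists (u / N), (- v / N); rewrite !(rmorphN, fmorph_div) /= eN.
move: xx0; rewrite mulf_eq0 => /norP[x0 x'0].
split; [rewrite -[LHS](mulfVK x'0) | rewrite -[LHS](mulfVK x0)].
  by rewrite {2}ex'; field; rewrite x0 x'0.
by rewrite {2}ex; field; rewrite x0 x'0.
Qed.

Lemma conj3_real (x x' : algC) :
  conj3 x x' -> x \is Num.real /\ x' \is Num.real.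
Proof.
have ratr_real (q : rat) : (ratr q : algC) \is Num.real.
  by apply: Creal_Crat; apply: Crat_rat.
by move=> [u [v [-> ->]]]; split; rewrite ?rpredB ?rpredD // rpredM // sqrt3_real.
Qed.

(** * Ambiguous numbers *)

Definition pos_amb (x x' : algC) : Prop := [/\ conj3 x x', 0 < x & x' < 0].

(** Irrationality comes for free: a rational number is its own conjugate, so it
    cannot have a conjugate of the opposite sign. *)
Lemma ambiguousP (x : algC) : ambiguous x <->
  exists x', pos_amb x x' \/ pos_amb (- x) (- x').
Proof.
split=> [[_ [a [b [c /= [c0 -> H]]]]]|[x' H]].
  exists ((a%:~R - b%:~R * sqrt3) / c%:~R).
  have c3 : conj3 ((a%:~R + b%:~R * sqrt3) / c%:~R)
                  ((a%:~R - b%:~R * sqrt3) / c%:~R).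
    exists (a%:~R / c%:~R), (b%:~R / c%:~R).
    by rewrite !fmorph_div /= !ratr_int; split; ring.
  case: H => [[? ?]|[? ?]]; [left|right]; split=> //; rewrite ?oppr_gt0 ?oppr_lt0 //.
  exact: conj3N.
have {H} [c3 H] : conj3 x x' /\ (0 < x /\ x' < 0 \/ x < 0 /\ 0 < x').
  case: H => -[c ? ?]; first by split=> //; left.
  split; last by right; split; [rewrite -oppr_gt0 | rewrite -oppr_lt0].
  by rewrite -[x]opprK -[x']opprK; apply: conj3N.
split.
  apply/negP => /CratP[q xq].
  move: (conj3_rat q); rewrite -xq => /(conj3_uniq c3) e.
  by move: H; rewrite e; case=> -[] /lt_trans h /h; rewrite ltxx.
case: c3 => u [v [ex ex']].
exists (numq u * denq v), (numq v * denq u), (denq u * denq v).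
have := denq_neq0 u; have := denq_neq0 v => dv du.
move: (dv) (du); rewrite -!(intr_eq0 algC) => dv' du'.
have E (e : algC) : ((numq u * denq v)%:~R + e * ((numq v * denq u)%:~R * sqrt3))
    / (denq u * denq v)%:~R = ratr u + e * (ratr v * sqrt3).
  rewrite /ratr !rmorphM /=.
  by field; rewrite dv'.
split; first by rewrite intr_eq0 mulf_neq0.
  by have := E 1; rewrite !mul1r -ex.
by have := E (-1); rewrite !mulN1r => ->; rewrite -ex'.
Qed.

Lemma pos_ambV (x x' : algC) : pos_amb x x' -> pos_amb x^-1 x'^-1.
Proof.
move=> [c x0 x'0]; split; first exact: conj3V.
  by rewrite invr_gt0.
by rewrite invr_lt0.
Qed.

Lemma pos_ambNV (x x' : algC) :
  pos_amb (- x) (- x') -> pos_amb (- x^-1) (- x'^-1).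
Proof. by move/pos_ambV; rewrite !invrN. Qed.

Lemma pos_amb_ambiguous (x x' : algC) : pos_amb x x' -> ambiguous x.
Proof. by move=> a; apply/ambiguousP; exists x'; left. Qed.

Lemma ambiguousV (x : algC) : ambiguous x -> ambiguous x^-1.
Proof.
move/ambiguousP=> [x' [a|/pos_ambNV a]]; apply/ambiguousP; exists x'^-1.
  by left; apply: pos_ambV.
by right.
Qed.

Lemma ambiguousN (x : algC) : ambiguous x -> ambiguous (- x).
Proof.
move/ambiguousP=> [x' [a|a]]; apply/ambiguousP; exists (- x').
  by right; rewrite !opprK.
by left.
Qed.

Lemma ambiguous_pos (x : algC) : ambiguous x ->
  exists x', pos_amb x x' \/ pos_amb (- x^-1) x'.
Proof.
move/ambiguousP=> [x' [a|/pos_ambNV a]]; first by exists x'; left.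
by exists (- x'^-1); right.
Qed.

Lemma ambiguous_gt0 (x : algC) : ambiguous x -> 0 < x -> exists x', pos_amb x x'.
Proof.
move=> /ambiguousP[x' [a|[_ h _]]] x0; exists x' => //.
by move: h; rewrite oppr_gt0 lt_gtF.
Qed.

Lemma ambiguous_conj_lt0 (x x' : algC) :
  ambiguous x -> conj3 x x' -> x' < 0 -> pos_amb x x'.
Proof.
move=> /ambiguousP[x1 H] c.
have -> : x' = x1.
  apply: conj3_uniq c _; case: H => -[] // cN _ _.
  by rewrite -[x]opprK -[x1]opprK; apply: conj3N.
by case: H => // -[_ _]; rewrite oppr_lt0 => h /(lt_trans h); rewrite ltxx.
Qed.

Lemma ambiguous_nonrat (x : algC) (q : int) : ambiguous x -> x != q%:~R.
Proof. by case=> xr _; apply: contraNneq xr => ->; apply: rpred_int. Qed.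

Lemma ambiguous_neq0 (x : algC) : ambiguous x -> x != 0.
Proof. exact: (@ambiguous_nonrat x 0). Qed.

Lemma ambiguous_add1_neq0 (x : algC) : ambiguous x -> x + 1 != 0.
Proof.
by move/(@ambiguous_nonrat x (-1)); rewrite rmorphN /= -subr_eq0 opprK.
Qed.

(** * Real points of an orbit of the Picard group *)

(** Written without a denominator: as soon as [d] is nonzero, [r x + s] cannot
    vanish, since [p x + q] and then [p s - q r] would vanish too. *)
Definition gl2 (d : int) (x y : algC) : Prop := exists p q r s : int,
  p * s - q * r = d /\ y * (r%:~R * x + s%:~R) = p%:~R * x + q%:~R.

(** Expanded, the relation reads [r x y + s y - p x - q = 0]; passing to the
    adjugate exchanges x and y in it, whatever the determinant is. *)
Lemma moebius_inv (p q r s : int) (x y : algC) :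
  y * (r%:~R * x + s%:~R) = p%:~R * x + q%:~R ->
  x * ((- r)%:~R * y + p%:~R) = s%:~R * y + (- q)%:~R.
Proof.
move=> e; rewrite !rmorphN /=; apply/eqP; rewrite -subr_eq0; apply/eqP.
transitivity ((p%:~R * x + q%:~R) - y * (r%:~R * x + s%:~R)); first by ring.
by rewrite e subrr.
Qed.

Lemma gl2_sym (d : int) (x y : algC) : gl2 d x y -> gl2 d y x.
Proof.
move=> [p [q [r [s [<- e]]]]]; exists s, (- q), (- r), p.
by split; [ring | exact: moebius_inv].
Qed.

Lemma gl2_trans (d e : int) (x y z : algC) :
  gl2 d x y -> gl2 e y z -> gl2 (d * e) x z.
Proof.
move=> [p [q [r [s [<- exy]]]]] [p2 [q2 [r2 [s2 [<- eyz]]]]].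
exists (p2 * p + q2 * r), (p2 * q + q2 * s), (r2 * p + s2 * r), (r2 * q + s2 * s).
split; first by ring.
set w := r%:~R * x + s%:~R in exy *.
have : z * (r2%:~R * (y * w) + s2%:~R * w) = p2%:~R * (y * w) + q2%:~R * w.
  by transitivity (z * (r2%:~R * y + s2%:~R) * w); [|rewrite eyz]; ring.
rewrite exy /w !rmorphD !rmorphM /= => h.
transitivity (z * (r2%:~R * (p%:~R * x + q%:~R) + s2%:~R * (r%:~R * x + s%:~R))).
  by ring.
by rewrite h; ring.
Qed.

Lemma moebius_conj3 (p q r s : int) (x x' y y' : algC) :
  conj3 x x' -> conj3 y y' -> y * (r%:~R * x + s%:~R) = p%:~R * x + q%:~R ->
  y' * (r%:~R * x' + s%:~R) = p%:~R * x' + q%:~R.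
Proof.
move=> cx cy e.
have H (a b : int) : conj3 (a%:~R * x + b%:~R) (a%:~R * x' + b%:~R).
  by apply: conj3D (conj3_int _); apply: conj3M cx; apply: conj3_int.
by apply: (conj3_uniq (conj3M cy (H r s))); rewrite e.
Qed.

(** Multiplying an integer matrix of determinant -1 by the imaginary unit gives
    a matrix of SL(2, Z[i]) that induces the same map. *)
Lemma gl2_picard (d : int) (x y : algC) :
  d = 1 \/ d = -1 -> gl2 d x y -> picard_orbit (Some x) (Some y).
Proof.
have gi (n : int) : gauss_int n%:~R by exists n, 0; rewrite mul0r addr0.
have gI (n : int) : gauss_int ('i * n%:~R) by exists 0, n; rewrite add0r mulrC.
move=> d1 [p [q [r [s [dE e]]]]].
have dC : p%:~R * s%:~R - q%:~R * r%:~R = d%:~R :> algC.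
  by rewrite -dE rmorphB !rmorphM.
have w0 : r%:~R * x + s%:~R != 0.
  apply/negP => /eqP w0; move: e; rewrite w0 mulr0 => e.
  have : d%:~R = 0 :> algC.
    rewrite -dC; transitivity (p%:~R * (r%:~R * x + s%:~R) - r%:~R * (p%:~R * x + q%:~R)).
      by ring.
    by rewrite w0 -e !mulr0 subrr.
  by case: d1 => -> /eqP; rewrite intr_eq0.
have yE : y = (p%:~R * x + q%:~R) / (r%:~R * x + s%:~R) by rewrite -e mulfK.
case: d1 dC => -> dC.
  exists p%:~R, q%:~R, r%:~R, s%:~R; split=> //.
  by rewrite /moebius (negPf w0) -yE.
exists ('i * p%:~R), ('i * q%:~R), ('i * r%:~R), ('i * s%:~R); split=> //.
  transitivity ('i ^+ 2 * (p%:~R * s%:~R - q%:~R * r%:~R) : algC); first by ring.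
  by rewrite dC sqrCi mulN1r rmorphN opprK.
by rewrite /moebius -!mulrA -!mulrDr mulf_eq0 (negPf (neq0Ci _)) (negPf w0)
  -mulf_div divff ?neq0Ci // mul1r yE.
Qed.

Lemma real_rect_eq0 (a b : algC) : a \is Num.real -> b \is Num.real ->
  a + 'i * b = 0 -> a = 0 /\ b = 0.
Proof.
move=> ra rb e; split.
  by rewrite -(Re_rect ra rb) e raddf0.
by rewrite -(Im_rect ra rb) e raddf0.
Qed.

(** With [y = M x] and [M = X + i Y], both X and Y map x to y as soon as they
    are invertible. Let w, z be the denominators of X, Y at x, and w', z' their
    conjugates. Then det X and det Y are w w' and z z' times the same factor,
    and that factor times w z' + w' z is the imaginary part of det M, that is 0;
    hence det X * det Y <= 0, while det X - det Y = 1. *)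
Lemma picard_gl2 (x x' y y' : algC) :
  conj3 x x' -> x != x' -> conj3 y y' ->
  picard_orbit (Some x) (Some y) -> gl2 1 x y \/ gl2 (-1) x y.
Proof.
move=> cx xx' cy [_ [_ [_ [_ [
  [[p1 [p2 ->]] [q1 [q2 ->]]] [[r1 [r2 ->]] [s1 [s2 ->]]] dE eq_y]]]]].
have [rx rx'] := conj3_real cx; have [ry ry'] := conj3_real cy.
have rz (n : int) : (n%:~R : algC) \is Num.real by apply: realz.
have [d1 d2] : (p1 * s1 - q1 * r1 - (p2 * s2 - q2 * r2) - 1)%:~R = 0 :> algC /\
    (p1 * s2 + p2 * s1 - q1 * r2 - q2 * r1)%:~R = 0 :> algC.
  apply: real_rect_eq0 => //; move/eqP: dE; rewrite -subr_eq0 => /eqP <-.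
  rewrite !(rmorphB, rmorphD, rmorphM) /=.
  transitivity (p1%:~R * s1%:~R - q1%:~R * r1%:~R
    + (- 1) * (p2%:~R * s2%:~R - q2%:~R * r2%:~R) - 1
    + 'i * (p1%:~R * s2%:~R + p2%:~R * s1%:~R - q1%:~R * r2%:~R
            - q2%:~R * r1%:~R) : algC); first by ring.
  by rewrite -sqrCi; ring.
have [e1 e2] : y * (r1%:~R * x + s1%:~R) - (p1%:~R * x + q1%:~R) = 0 /\
  y * (r2%:~R * x + s2%:~R) - (p2%:~R * x + q2%:~R) = 0.
  apply: real_rect_eq0; rewrite ?(rpredB, rpredD, rpredM) ?rpredD ?rpredM //.
  move: eq_y; rewrite /moebius; case: eqVneq => // w0 [yE].
  transitivity (y * ((r1%:~R + r2%:~R * 'i) * x + (s1%:~R + s2%:~R * 'i))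
     - ((p1%:~R + p2%:~R * 'i) * x + (q1%:~R + q2%:~R * 'i))); first by ring.
  by rewrite yE mulfVK // subrr.
move: e1 e2 => /eqP; rewrite subr_eq0 => /eqP e1 /eqP; rewrite subr_eq0 => /eqP e2.
have e1' := moebius_conj3 cx cy e1; have e2' := moebius_conj3 cx cy e2.
set w := r1%:~R * x + s1%:~R in e1 *; set w' := r1%:~R * x' + s1%:~R in e1' *.
set z := r2%:~R * x + s2%:~R in e2 *; set z' := r2%:~R * x' + s2%:~R in e2' *.
pose D1 := p1 * s1 - q1 * r1; pose D2 := p2 * s2 - q2 * r2.
have D1E : D1%:~R * (x - x') = (y - y') * (w * w').
  transitivity (y * w * w' - y' * w' * w); last by ring.
  by rewrite e1 e1' /D1 /w /w' rmorphB !rmorphM /=; ring.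
have D2E : D2%:~R * (x - x') = (y - y') * (z * z').
  transitivity (y * z * z' - y' * z' * z); last by ring.
  by rewrite e2 e2' /D2 /z /z' rmorphB !rmorphM /=; ring.
have D0E : 0 = (y - y') * (w * z' + w' * z).
  transitivity ((p1 * s2 + p2 * s1 - q1 * r2 - q2 * r1)%:~R * (x - x')).
    by rewrite d2 mul0r.
  transitivity (y * w * z' - y' * z' * w + (y * z * w' - y' * w' * z)); last by ring.
  rewrite e1 e1' e2 e2' /w /w' /z /z' !(rmorphB, rmorphD, rmorphM) /=; ring.
have D12 : (D1 * D2)%:~R * (x - x') ^+ 2 = - ((y - y') * (w * z')) ^+ 2.
  transitivity ((D1%:~R * (x - x')) * (D2%:~R * (x - x'))).
    by rewrite rmorphM /=; ring.
  rewrite D1E D2E; apply/eqP; rewrite -subr_eq0; apply/eqP.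
  transitivity ((y - y') * (w * z') * ((y - y') * (w * z' + w' * z))); first by ring.
  by rewrite -D0E mulr0.
have D12_le0 : D1 * D2 <= 0.
  rewrite leNgt; apply/negP => D12_gt0.
  have : 0 < (D1 * D2)%:~R * (x - x') ^+ 2.
    rewrite mulr_gt0 ?ltr0z // real_exprn_even_gt0 ?rpredB //=.
    by rewrite subr_eq0.
  have rK : (y - y') * (w * z') \is Num.real.
    by rewrite rpredM ?rpredB // rpredM // rpredD // rpredM.
  by rewrite D12 oppr_gt0 real_ltNge ?rpredX ?rpred0 // real_exprn_even_ge0.
have D12E : D1 - D2 = 1.
  by apply/eqP; rewrite -subr_eq0 -(intr_eq0 algC) -/D1 d1.
have [D10|D11] : D1 = 0 \/ D1 = 1 by nia.
  right; exists p2, q2, r2, s2; split=> //.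
  by rewrite -/D2; lia.
by left; exists p1, q1, r1, s1.
Qed.

Lemma gl2V (x : algC) : x != 0 -> gl2 (-1) x x^-1.
Proof.
by move=> x0; exists 0, 1, 1, 0; split=> //; rewrite mul0r mul1r addr0 add0r mulVf.
Qed.

Lemma gl2NV (x : algC) : x != 0 -> gl2 1 x (- x^-1).
Proof.
move=> x0; exists 0, (-1), 1, 0; split=> //.
by rewrite mul0r mul1r addr0 add0r mulNr mulVf.
Qed.

Definition pgl2 (x y : algC) : Prop := gl2 1 x y \/ gl2 (-1) x y.

Lemma pgl2_refl (x : algC) : pgl2 x x.
Proof. by left; exists 1, 0, 0, 1; split=> //; ring. Qed.

Lemma pgl2_sym (x y : algC) : pgl2 x y -> pgl2 y x.
Proof. by case=> /gl2_sym; [left | right]. Qed.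

Lemma pgl2_trans (x y z : algC) : pgl2 x y -> pgl2 y z -> pgl2 x z.
Proof.
case=> xy [] yz; have := gl2_trans xy yz; rewrite ?mulrNN ?mulr1 ?mul1r;
  by rewrite /pgl2; tauto.
Qed.

Lemma ambiguous_orbitP (x y : algC) : ambiguous x -> ambiguous y ->
  picard_orbit (Some x) (Some y) <-> pgl2 x y.
Proof.
move=> /ambiguousP[x' ax] /ambiguousP[y' ay].
have pos3 (u u' : algC) : pos_amb u u' \/ pos_amb (- u) (- u') ->
    conj3 u u' /\ u != u'.
  case=> -[c h1 h2]; split=> //.
  - by apply: contraTneq h1 => ->; rewrite lt_gtF.
  - by rewrite -[u]opprK -[u']opprK; apply: conj3N.
  - by apply: contraTneq h1 => ->; rewrite lt_gtF.
have [cx xx'] := pos3 _ _ ax; have [cy _] := pos3 _ _ ay.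
split; first exact: picard_gl2 cx xx' cy.
by case; apply: gl2_picard; [left | right].
Qed.

(** * Farey steps and SL(2, Z)-equivalence *)

(** The two parabolic maps that generate the monoid of matrices of SL(2, Z) with
    natural entries. *)
Definition farey_step (z y : algC) : Prop := y = z + 1 \/ y = z / (z + 1).

Lemma farey_stepV (z y : algC) : 0 < z -> farey_step z y -> farey_step z^-1 y^-1.
Proof.
move=> z0; have zn := lt0r_neq0 z0; have z1 := lt0r_neq0 (addr_gt0 z0 ltr01).
by case=> ->; [right|left]; field; rewrite ?z1 ?zn // addrC z1.
Qed.

(** The images of positive numbers by the two maps are separated by 1. *)
Lemma farey_step_inj (z1 z1' z2 z2' y : algC) :
  pos_amb z1 z1' -> pos_amb z2 z2' ->
  farey_step z1 y -> farey_step z2 y -> z1 = z2.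
Proof.
have lt1 (a b : algC) : 0 < a -> 0 < b -> a + 1 <> b / (b + 1).
  move=> a0 b0 e.
  have : b / (b + 1) < 1.
    by rewrite ltr_pdivrMr ?mul1r ?ltrDl ?addr_gt0.
  by rewrite -e gtrDr; apply/negP; rewrite lt_gtF.
move=> [_ z10 _] [_ z20 _] [->|->] [].
- by move/addIr.
- by move/(lt1 _ _ z10 z20).
- by move/esym/(lt1 _ _ z20 z10).
have h1 := lt0r_neq0 (addr_gt0 z10 ltr01); have h2 := lt0r_neq0 (addr_gt0 z20 ltr01).
move/eqP; rewrite eqr_div // => /eqP e.
transitivity (z1 * (z2 + 1) - z1 * z2); first by ring.
by rewrite e; ring.
Qed.

(** The sign of [z' + 1] decides which of the two steps stays ambiguous. *)
Lemma farey_step_fun (z z' y1 y1' y2 y2' : algC) :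
  pos_amb z z' -> pos_amb y1 y1' -> pos_amb y2 y2' ->
  farey_step z y1 -> farey_step z y2 -> y1 = y2.
Proof.
have contra (a a' : algC) : pos_amb (z + 1) a -> pos_amb (z / (z + 1)) a' ->
    pos_amb z z' -> False.
  move=> [c1 _ n1] [c2 _ n2] [c _ n].
  have c1' := conj3D c conj3_1.
  move: n1 n2; rewrite -(conj3_uniq c1' c1) -(conj3_uniq (conj3M c (conj3V c1')) c2).
  by move=> n1; rewrite nmulr_rlt0 // invr_gt0 lt_gtF.
move=> az a1 a2 [e1|e1] [e2|e2]; rewrite ?e1 ?e2 //.
  by move: a1 a2; rewrite e1 e2 => a1 a2; case: (contra _ _ a1 a2 az).
by move: a1 a2; rewrite e1 e2 => a1 a2; case: (contra _ _ a2 a1 az).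
Qed.

(** One row dominates the other, so that a row can be subtracted from the other:
    this is the induction step in the factorisation of a matrix of SL(2, N). *)
Lemma sl2_nat_cases (p q r s : nat) : (p * s = q * r + 1)%N ->
  [\/ q = 0%N /\ r = 0%N, (r <= p)%N /\ (s <= q)%N | (p <= r)%N /\ (q <= s)%N].
Proof.
move=> e; case: (leqP r p) => rp; case: (leqP s q) => sq.
- exact: Or32.
- case: (ltngtP r p) rp => // [rp|rp] _; first by apply: Or31; nia.
  by apply: Or33; split; lia.
- by nia.
- by apply: Or33; split; lia.
Qed.

Lemma lin_gt0 (p q : nat) (x : algC) : (0 < p + q)%N -> 0 < x ->
  0 < p%:R * x + q%:R.
Proof.
case: p => [|p] h x0; first by rewrite mul0r add0r ltr0n.
by rewrite ltr_wpDr ?ler0n // mulr_gt0 ?ltr0n.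
Qed.

(** [p s] and [q r] are consecutive integers, so a positive sum means
    [p s > 0] and [q r >= 0]. *)
Lemma sl2_sign (p q r s : int) : p * s - q * r = 1 -> 0 < p * s + q * r ->
  [\/ [/\ 0 <= p, 0 <= q, 0 <= r & 0 <= s],
      [/\ p <= 0, q <= 0, r <= 0 & s <= 0],
      [/\ 0 <= p, q <= 0, r <= 0 & 0 <= s] |
      [/\ p <= 0, 0 <= q, 0 <= r & s <= 0]].
Proof.
move=> d t; have ps : 0 < p * s by lia.
have qr : 0 <= q * r by lia.
case: (lerP 0 p) => p0; case: (lerP 0 q) => q0.
- have s0 : 0 <= s by nia.
  case: (lerP 0 r) => r0; first by apply: Or41.
  by apply: Or43; split=> //; nia.
- by apply: Or43; split=> //; nia.
- have s0 : s <= 0 by nia.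
  case: (lerP 0 r) => r0; first by apply: Or44; split=> //; apply: ltW.
  by apply: Or42; split; nia.
- by apply: Or42; split; nia.
Qed.

(** [p s + q r] is the middle coefficient of [(p X + q)(r X + s)], whose extreme
    coefficients have a nonnegative product [(p s)(q r)]. This polynomial is
    nonnegative at x > 0 and nonpositive at x' < 0, which excludes a negative
    middle coefficient. *)
Lemma sl2_trace_gt0 (p q r s : int) (x x' y y' : algC) : p * s - q * r = 1 ->
  pos_amb x x' -> pos_amb y y' ->
  y * (r%:~R * x + s%:~R) = p%:~R * x + q%:~R -> 0 < p * s + q * r.
Proof.
move=> d [cx x0 x'0] [cy y0 y'0] e.
have e' := moebius_conj3 cx cy e.
have [rx rx'] := conj3_real cx.
have rz (n : int) : (n%:~R : algC) \is Num.real by apply: realz.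
have Qx : 0 <= (p%:~R * x + q%:~R) * (r%:~R * x + s%:~R).
  rewrite -e -mulrA mulr_ge0 ?(ltW y0) //.
  by rewrite -expr2 real_exprn_even_ge0 // rpredD // rpredM.
have Qx' : (p%:~R * x' + q%:~R) * (r%:~R * x' + s%:~R) <= 0.
  rewrite -e' -mulrA nmulr_rle0 //.
  by rewrite -expr2 real_exprn_even_ge0 // rpredD // rpredM.
have QE (t : algC) : (p%:~R * t + q%:~R) * (r%:~R * t + s%:~R) =
    (p * r)%:~R * t ^+ 2 + (p * s + q * r)%:~R * t + (q * s)%:~R.
  by rewrite !(rmorphD, rmorphM) /=; ring.
rewrite ltNge; apply/negP => T0'.
have T0 : p * s + q * r < 0 by lia.
have acE : (p * r) * (q * s) = (q * r + 1) * (q * r).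
  have -> : q * r + 1 = p * s by lia.
  by ring.
have [[pr qs]|[pr qs]] : (0 <= p * r /\ 0 <= q * s) \/ (p * r <= 0 /\ q * s <= 0).
  have : 0 <= (p * r) * (q * s) by rewrite acE; nia.
  by move: (p * r) (q * s) => a c; nia.
- move: Qx'; rewrite QE; apply/negP; rewrite lt_geF //.
  rewrite ltr_pwDl ?ler0z // ltr_wpDl //.
    by rewrite mulr_ge0 ?ler0z // real_exprn_even_ge0.
  by rewrite nmulr_lgt0 // ltrz0.
- move: Qx; rewrite QE; apply/negP; rewrite lt_geF //.
  rewrite ltr_nwDl ?lerz0 // ltr_wnDl //.
    by rewrite mulr_le0_ge0 ?lerz0 // real_exprn_even_ge0.
  by rewrite pmulr_llt0 // ltrz0.
Qed.

Section StepInvariant.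

Variable K : algC -> Prop.
Hypothesis K_step : forall z z' y y', pos_amb z z' -> pos_amb y y' ->
  farey_step z y -> (K z <-> K y).

(** Stripping the last factor of the matrix undoes a Farey step at y. The new
    number is positive because it is the image of x > 0 by a matrix with natural
    entries, and its conjugate is negative because y' is. *)
Lemma sl2_nat_invariant (p q r s : nat) (x x' y y' : algC) :
  (p * s = q * r + 1)%N -> pos_amb x x' -> pos_amb y y' ->
  y * (r%:R * x + s%:R) = p%:R * x + q%:R -> (K x <-> K y).
Proof.
have [n] := ubnP (p + q + r + s); elim: n p q r s y y' => // n IH p q r s y y' le_n det.
move=> ax ay e; have [cx x0 x'0] := ax; have [cy y0 y'0] := ay.
have w0 : 0 < r%:R * x + s%:R by apply: lin_gt0 => //; nia.
have wn := lt0r_neq0 w0.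
have [[q0 r0]|[rp sq]|[pr qs]] := sl2_nat_cases det.
- move: e; rewrite q0 r0 mul0r addr0 add0r.
  move: det; rewrite q0 mul0n add0n => /eqP; rewrite muln_eq1.
  move=> /andP[/eqP-> /eqP->].
  by rewrite mulr1 mul1r => ->.
- have ez : (y - 1) * (r%:R * x + s%:R) = (p - r)%:R * x + (q - s)%:R.
    by rewrite mulrBl e !natrB //; ring.
  have az : pos_amb (y - 1) (y' - 1).
    split; first exact: conj3D cy (conj3N conj3_1).
      by rewrite -(pmulr_lgt0 _ w0) ez lin_gt0 //; nia.
    by rewrite subr_lt0 (lt_trans y'0).
  rewrite (IH _ _ _ _ _ _ _ _ ax az ez); [|by nia|by nia].
  by apply: (K_step az ay); left; rewrite subrK.
- have ew : (1 - y) * (r%:R * x + s%:R) = (r - p)%:R * x + (s - q)%:R.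
    by rewrite mulrBl e !natrB //; ring.
  have y1 : 0 < 1 - y.
    by rewrite -(pmulr_lgt0 _ w0) ew lin_gt0 //; nia.
  have y1n := lt0r_neq0 y1.
  have az : pos_amb (y / (1 - y)) (y' / (1 - y')).
    split; last 1 first.
    + by rewrite pmulr_llt0 // invr_gt0 subr_gt0 (lt_trans y'0).
    + exact: conj3M cy (conj3V (conj3D conj3_1 (conj3N cy))).
    by rewrite divr_gt0.
  have ez : y / (1 - y) * ((r - p)%:R * x + (s - q)%:R) = p%:R * x + q%:R.
    by rewrite -ew mulrA divfK.
  rewrite (IH _ _ _ _ _ _ _ _ ax az ez); [|by nia|by nia].
  by apply: (K_step az ay); right; field; rewrite y1n addrC subrK oner_neq0.
Qed.

(** By the two sign lemmas, the matrix or its inverse has, up to a global sign,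
    natural entries. *)
Lemma sl2_invariant (x x' y y' : algC) :
  pos_amb x x' -> pos_amb y y' -> gl2 1 x y -> (K x <-> K y).
Proof.
move=> ax ay g.
have nonneg (p q r s : int) (u u' v v' : algC) :
    [/\ 0 <= p, 0 <= q, 0 <= r & 0 <= s] -> p * s - q * r = 1 ->
    pos_amb u u' -> pos_amb v v' ->
    v * (r%:~R * u + s%:~R) = p%:~R * u + q%:~R -> (K u <-> K v).
  case: p q r s => p [] q [] r [] s [] //= _ _ _ _ d au av e.
  by apply: (sl2_nat_invariant (p := p) (q := q) (r := r) (s := s) _ au av e); lia.
have [p [q [r [s [d e]]]]] := g; have e' := moebius_inv e.
have opp (t : int) : (- t)%:~R = - t%:~R :> algC by rewrite rmorphN.
case: (sl2_sign d (sl2_trace_gt0 d ax ay e)) => H.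
- exact: nonneg H d ax ay e.
- apply: (nonneg (- p) (- q) (- r) (- s) _ _ _ _ _ _ ax ay).
  + by case: H => *; split; lia.
  + by rewrite -d; ring.
  rewrite !opp.
  by transitivity (- (y * (r%:~R * x + s%:~R))); [|rewrite e]; ring.
- symmetry; apply: (nonneg s (- q) (- r) p _ _ _ _ _ _ ay ax e').
  + by case: H => *; split; lia.
  + by rewrite -d; ring.
- symmetry; apply: (nonneg (- s) q r (- p) _ _ _ _ _ _ ay ax).
  + by case: H => *; split; lia.
  + by rewrite -d; ring.
  move: e'; rewrite !opp => e'.
  by transitivity (- (x * (- r%:~R * y + p%:~R))); [|rewrite e']; ring.
Qed.

End StepInvariant.

(** * A circuit absorbs its orbit *)

Lemma genBE (x : algC) : x != 0 -> genB (Some x) = Some x^-1.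
Proof.
by move=> x0; rewrite /genB /= mul1r addr0 (negPf x0) mul0r add0r mul1r.
Qed.

Lemma genDE (x : algC) : x != 0 -> genD (Some x) = Some (- x^-1).
Proof.
by move=> x0; rewrite /genD /= mul1r addr0 (negPf x0) mul0r add0r mulN1r.
Qed.

Lemma genCE (x : algC) : x != 0 -> genC (Some x) = Some (- 1 - x^-1).
Proof.
move=> x0; rewrite /genC /= mul1r mulN1r addr0 oppr_eq0 (negPf x0).
by congr Some; field; rewrite x0.
Qed.

Lemma genCCE (x : algC) : x != 0 -> x + 1 != 0 ->
  genC (genC (Some x)) = Some (- (x + 1)^-1).
Proof.
move=> x0 x1; rewrite genCE // genCE.
  by congr Some; field; rewrite x0 x1 mulN1r -opprD oppr_eq0 x1.
have -> : -1 - x^-1 = - ((x + 1) / x) by field.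
by rewrite oppr_eq0 mulf_neq0 ?invr_eq0.
Qed.

Section Circuit.

Variables (n : nat) (beta : nat -> algC).
Hypothesis beta_circuit : circuit n beta.

Definition on_circuit (x : algC) : Prop := exists2 i, (i < n.*2)%N & x = beta i.

Lemma on_circuit_ambiguous (x : algC) : on_circuit x -> ambiguous x.
Proof. by case: beta_circuit => _ amb _ _ _ [i lt_i ->]; apply: amb. Qed.

Lemma on_circuit_D (x : algC) : on_circuit x -> on_circuit (- x^-1).
Proof.
move=> Kx; have := ambiguous_neq0 (on_circuit_ambiguous Kx).
case: Kx => i lt_i -> bi0.
have [n0 amb _ _ eD] := beta_circuit.
have bD j : (j < n)%N -> beta (j.*2.+2 %% n.*2)%N = - (beta j.*2.+1)^-1.
  move=> lt_j; have := eD j lt_j; rewrite genDE => [[]//|].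
  by apply: ambiguous_neq0; apply: amb; lia.
case: (boolP (odd i)) => oi.
  have iE : i = (i./2.*2.+1)%N by lia.
  exists (i./2.*2.+2 %% n.*2)%N; first by rewrite ltn_mod double_gt0.
  by rewrite bD -?iE //; lia.
(* The D-edge that enters an even index i comes from index i - 1, read
   modulo 2n. *)
pose k := (if i == 0%N then n.-1 else i./2.-1).
have kn : (k < n)%N by rewrite /k; case: eqP; lia.
have ik : (k.*2.+2 %% n.*2)%N = i.
  rewrite /k; case: eqP => i0; last by rewrite modn_small; lia.
  by rewrite i0 -doubleS prednK // modnn.
exists (k.*2.+1); first by lia.
by rewrite -ik bD // invrN invrK opprK.
Qed.

(** The disjunction is symmetric because C and its square are mutually
    inverse, so it holds at both ends of a C-edge. *)
Lemma on_circuit_C (x : algC) : on_circuit x ->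
  exists y, on_circuit y /\ (y = -1 - x^-1 \/ y = - (x + 1)^-1).
Proof.
move=> [i lt_i ->]; have [_ amb _ eC _] := beta_circuit.
have bC j : (j < n)%N -> beta j.*2.+1 = -1 - (beta j.*2)^-1 \/
    beta j.*2.+1 = - (beta j.*2 + 1)^-1.
  move=> lt_j; have a : ambiguous (beta j.*2) by apply: amb; lia.
  have := eC j lt_j.
  have b0 := ambiguous_neq0 a; have b1 := ambiguous_add1_neq0 a.
  rewrite (genCCE b0 b1) (genCE b0).
  by case=> -[]; [left | right].
have lt_i2 : (i./2 < n)%N by lia.
case: (boolP (odd i)) => oi.
  have iE : i = (i./2.*2.+1)%N by lia.
  exists (beta i./2.*2); split; first by exists i./2.*2 => //; lia.
  have := bC _ lt_i2; rewrite -iE => -[] ->; [right | left].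
    by rewrite addrAC addNr add0r invrN invrK opprK.
  by rewrite invrN invrK; ring.
have iE : i = (i./2.*2)%N by lia.
exists (beta i.+1); split; first by exists i.+1 => //; lia.
by have := bC _ lt_i2; rewrite -iE.
Qed.

(** From z, a C-edge and then a D-edge lead to a Farey step of z; from y, a
    D-edge and then a C-edge lead to a number of which y is a Farey step. Uniqueness of
    ambiguous Farey steps in both directions identifies these numbers. *)
Lemma on_circuit_step (z z' y y' : algC) : pos_amb z z' -> pos_amb y y' ->
  farey_step z y -> (on_circuit z <-> on_circuit y).
Proof.
move=> az ay zy; have [_ z0 _] := az; have [cy y0 y'0] := ay.
have zn := lt0r_neq0 z0; have z1n := lt0r_neq0 (addr_gt0 z0 ltr01).
split=> [Kz|Ky].
  have [w [/on_circuit_D Kw wE]] := on_circuit_C Kz.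
  have zw : farey_step z (- w^-1).
    case: wE => ->; [right|left].
      by field; rewrite zn z1n mulN1r -opprD oppr_eq0 z1n.
    by rewrite invrN invrK opprK.
  have [v' av] : exists v', pos_amb (- w^-1) v'.
    apply: ambiguous_gt0; first exact: on_circuit_ambiguous.
    by case: zw => ->; rewrite ?divr_gt0 ?addr_gt0.
  by rewrite (farey_step_fun az ay av zy zw).
have [w [Kw wE]] := on_circuit_C (on_circuit_D Ky).
have aw := on_circuit_ambiguous Kw.
have yn := lt0r_neq0 y0.
have y1 : 1 - y != 0.
  have := ambiguous_add1_neq0 (ambiguousN (pos_amb_ambiguous ay)).
  by rewrite addrC.
have {}wE : w = y - 1 \/ w = y / (1 - y).
  case: wE => ->; [left | right]; first by rewrite invrN invrK opprK addrC.
  by field; rewrite yn y1 -oppr_eq0 opprD opprK.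
have wy : farey_step w y.
  case: wE => ->; [left | right]; first by rewrite subrK.
  by field; rewrite y1 addrC subrK oner_neq0.
have [w' aw'] : exists w', pos_amb w w'.
  case: wE => wE; [exists (y' - 1) | exists (y' / (1 - y'))];
    apply: ambiguous_conj_lt0 aw _ _; rewrite ?wE.
  - exact: conj3D cy (conj3N conj3_1).
  - by rewrite subr_lt0 (lt_trans y'0).
  - exact: conj3M cy (conj3V (conj3D conj3_1 (conj3N cy))).
  - by rewrite pmulr_llt0 // invr_gt0 subr_gt0 (lt_trans y'0).
by rewrite (farey_step_inj az aw' zy wy).
Qed.

(** As B is an involution, [on_circuit x^-1] puts x in the image of the circuit
    by B. *)
Definition on_path (x : algC) : Prop := on_circuit x \/ on_circuit x^-1.

Lemma on_pathV (x : algC) : on_path x^-1 -> on_path x.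
Proof. by rewrite /on_path invrK; tauto. Qed.

Lemma on_path_step (z z' y y' : algC) : pos_amb z z' -> pos_amb y y' ->
  farey_step z y -> (on_path z <-> on_path y).
Proof.
move=> az ay zy; have zy' : farey_step z^-1 y^-1 by apply: farey_stepV zy; case: az.
have := on_circuit_step az ay zy.
have := on_circuit_step (pos_ambV az) (pos_ambV ay) zy'.
by rewrite /on_path; tauto.
Qed.

(** Positive numbers equivalent to the circuit by determinant 1 are on it;
    determinant -1 is corrected by B, and negative numbers by D. *)
Lemma on_path_full (x : algC) : ambiguous x -> pgl2 (beta 0) x -> on_path x.
Proof.
move=> ax gx.
have K0 : on_circuit (beta 0) by exists 0%N; case: beta_circuit => //; lia.
have [g [g' [Kg ag bg]]] : exists g g',
    [/\ on_circuit g, pos_amb g g' & pgl2 (beta 0) g].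
  have a0 := on_circuit_ambiguous K0.
  have [g' [ag|ag]] := ambiguous_pos a0.
    by exists (beta 0), g'; split=> //; apply: pgl2_refl.
  exists (- (beta 0)^-1), g'; split=> //; first exact: on_circuit_D.
  by left; apply: gl2NV; apply: ambiguous_neq0.
have {gx bg} gx := pgl2_trans (pgl2_sym bg) gx.
have posx (u u' : algC) : pos_amb u u' -> pgl2 g u -> on_path u.
  move=> au [gu|gu].
    by apply/(sl2_invariant on_path_step ag au gu); left.
  apply: on_pathV; apply/(sl2_invariant on_path_step ag (pos_ambV au)); last by left.
  have := gl2_trans gu (gl2V (ambiguous_neq0 (pos_amb_ambiguous au))).
  by rewrite mulrNN mulr1.
have [x' [ax'|ax']] := ambiguous_pos ax; first exact: posx ax' gx.
have /(posx _ _ ax') : pgl2 g (- x^-1).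
  by apply: pgl2_trans gx _; left; apply: gl2NV; apply: ambiguous_neq0.
by case=> /on_circuit_D; rewrite !invrN !invrK !opprK => Kx; [left | right].
Qed.

End Circuit.

(** * Periodicity of Farey steps and existence of a circuit *)

Definition form : Type := (int * int * int)%type.

(** The triple (a, b, c) stands for a X^2 + b X + c, whose two roots are
    conjugate in Q(sqrt 3) and of opposite signs. *)
Definition ambiguous_form (m : int) (t : form) : bool :=
  let: (a, b, c) := t in [&& 0 < a, c < 0 & b ^+ 2 - 4 * a * c == 3 * m ^+ 2].

(** The positive root of the form, when m > 0. *)
Definition form_root (m : int) (t : form) : algC :=
  let: (a, b, c) := t in ((- b)%:~R + m%:~R * sqrt3) / (2 * a)%:~R.

(** The form whose roots are the Farey steps of the roots of [t]: the value
    [a - b + c] of the form at -1 tells on which side of -1 the negative root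
    is. *)
Definition next_form (t : form) : form :=
  let: (a, b, c) := t in
  if a - b + c < 0 then (a, b - 2 * a, a - b + c) else (a - b + c, b - 2 * c, c).

(** The inverse of [next_form] on ambiguous forms. A number reached by the step
    x + 1 exceeds 1, one reached by x / (x + 1) does not, and the sign of the
    value [a + b + c] of the form at 1 separates the two cases. *)
Definition prev_form (t : form) : form :=
  let: (a, b, c) := t in
  if a + b + c < 0 then (a, b + 2 * a, a + b + c) else (a + b + c, b + 2 * c, c).

(** Otherwise the discriminant 3 m^2 would be the square (a - c)^2. *)
Lemma form_mediant_neq0 (m a b c : int) : ambiguous_form m (a, b, c) ->
  a - b + c != 0.
Proof.
move=> /and3P[a0 c0 /eqP d]; apply/negP => /eqP e.
have h : (a - c) ^+ 2 = 3 * m ^+ 2.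
  by rewrite -d (_ : b = a + c); [ring | lia].
by have m0 := sqr_eq_3sqr_eq0 h; move: h; rewrite m0; nia.
Qed.

Lemma next_ambiguous_form (m : int) (t : form) :
  ambiguous_form m t -> ambiguous_form m (next_form t).
Proof.
case: t => [[a b] c] H; have := form_mediant_neq0 H.
move: H => /and3P[a0 c0 /eqP d]; rewrite /next_form /ambiguous_form.
case: (boolP (a - b + c < 0)) => h n0; apply/and3P; split=> //.
- by rewrite -d; apply/eqP; ring.
- by lia.
by rewrite -d; apply/eqP; ring.
Qed.

Lemma next_formK (m : int) (t : form) : ambiguous_form m t ->
  prev_form (next_form t) = t.
Proof.
case: t => [[a b] c] /and3P[a0 c0 _]; rewrite /next_form; case: ifP => _ /=.
  have -> : a + (b - 2 * a) + (a - b + c) < 0 by lia.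
  by congr (_, _, _); ring.
have -> : (a - b + c + (b - 2 * c) + c < 0) = false by lia.
by congr (_, _, _); ring.
Qed.

Section Forms.

Variable m : int.
Hypothesis m_gt0 : 0 < m.

Lemma form_root_pos_amb (t : form) : ambiguous_form m t ->
  exists x', pos_amb (form_root m t) x'.
Proof.
case: t => [[a b] c] /and3P[a0 c0 /eqP d] /=.
have a20 : (0 : algC) < (2 * a)%:~R by rewrite ltr0z; lia.
have s0 : 0 < m%:~R * sqrt3 by rewrite mulr_gt0 ?ltr0z ?sqrt3_gt0.
have c3 : conj3 (((- b)%:~R + m%:~R * sqrt3) / (2 * a)%:~R)
                (((- b)%:~R - m%:~R * sqrt3) / (2 * a)%:~R).
  exists ((- b)%:~R / (2 * a)%:~R), (m%:~R / (2 * a)%:~R).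
  by rewrite !fmorph_div /= !ratr_int; split; ring.
have lt_bm : `|(- b)%:~R| < m%:~R * sqrt3.
  have : `|(- b)%:~R : algC| ^+ 2 < (m%:~R * sqrt3) ^+ 2.
    rewrite real_normK ?realz // exprMn sqrt3_sq -!rmorphXn -[3]/(3%:~R) -rmorphM ltr_int.
    by nia.
  by rewrite ltr_pXn2r // ?nnegrE ?normr_ge0 ?(ltW s0).
move: lt_bm; rewrite real_ltr_norml ?realz // => /andP[lo hi].
exists (((- b)%:~R - m%:~R * sqrt3) / (2 * a)%:~R); split=> //.
  by rewrite divr_gt0 // -ltrBlDr sub0r.
by rewrite pmulr_llt0 ?invr_gt0 // subr_lt0.
Qed.

Lemma form_root_step (t : form) : ambiguous_form m t ->
  farey_step (form_root m t) (form_root m (next_form t)).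
Proof.
case: t => [[a b] c] H; have abc0 := form_mediant_neq0 H.
have [x' [_ x0 _]] := form_root_pos_amb H; have x1 := lt0r_neq0 (addr_gt0 x0 ltr01).
move: H => /and3P[a0 c0 /eqP d]; rewrite /= in x1 *.
have an0 : (a%:~R : algC) != 0 by rewrite intr_eq0 lt0r_neq0.
have : ((a - b + c)%:~R : algC) != 0 by rewrite intr_eq0.
have w2 : (m%:~R * sqrt3) ^+ 2 = b%:~R ^+ 2 - 4 * a%:~R * c%:~R.
  have <- : (b ^+ 2 - 4 * a * c)%:~R = b%:~R ^+ 2 - 4 * a%:~R * c%:~R :> algC.
    by rewrite rmorphB /= rmorphXn /= !rmorphM.
  by rewrite d rmorphM /= rmorphXn /= exprMn sqrt3_sq mulrC.
move: x1 w2; case: ifP => _ /=; set w := m%:~R * sqrt3;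
  rewrite !(rmorphN, rmorphB, rmorphM, rmorphD, rmorph1) /= => x1 w2 abc.
  by left; field.
right; apply: (mulIf x1); rewrite divfK //.
set A : algC := a%:~R in an0 abc x1 w2 *; set B : algC := b%:~R in abc x1 w2 *.
set C : algC := c%:~R in abc x1 w2 *.
(* The two sides agree up to a multiple of w^2 - (b^2 - 4ac) = 0. *)
transitivity (((w ^+ 2 - (B ^+ 2 - 4 * A * C)) + (- B + w) * (2 * (A - B + C)))
   / (2 * (A - B + C) * (2 * A))); first by field; rewrite an0.
by rewrite w2 subrr add0r; field; rewrite an0.
Qed.

(** The coefficient of sqrt 3 in the root determines a, the rational part then
    determines b, and the discriminant c. *)
Lemma form_root_inj (t1 t2 : form) : ambiguous_form m t1 -> ambiguous_form m t2 ->
  form_root m t1 = form_root m t2 -> t1 = t2.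
Proof.
case: t1 t2 => [[a b] c] [[a2 b2] c2].
move=> /and3P[a0 c0 /eqP d] /and3P[a20 c20 /eqP d2] /= e.
have := @ratr_sqrt3_eq0 ((- b)%:~R / (2 * a)%:~R - (- b2)%:~R / (2 * a2)%:~R)
  (m%:~R / (2 * a)%:~R - m%:~R / (2 * a2)%:~R).
rewrite !rmorphB !fmorph_div /= !ratr_int.
have -> : forall u v w u2 v2 r : algC, u / v - u2 / v2 + (w / v - w / v2) * r =
   (u + w * r) / v - (u2 + w * r) / v2 by move=> *; ring.
rewrite e subrr => /(_ erefl) [eb /eqP].
have an : (2 * a)%:~R != 0 :> rat by rewrite intr_eq0; lia.
have a2n : (2 * a2)%:~R != 0 :> rat by rewrite intr_eq0; lia.
rewrite subr_eq0 eqr_div // => /eqP; rewrite -!rmorphM => /intr_inj ea.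
have {ea} ea : a = a2 by nia.
subst a2; move/eqP: eb; rewrite subr_eq0 => /eqP /(mulIf (invr_neq0 an)) /intr_inj eb.
have {eb} eb : b = b2 by lia.
subst b2; congr (_, _, _); nia.
Qed.

End Forms.

(** Since a > 0 > c, both b^2 and - 4 a c are at most 3 m^2. *)
Lemma ambiguous_form_finite (m : int) : exists L : seq form,
  forall t, ambiguous_form m t -> t \in L.
Proof.
pose N := absz (3 * m ^+ 2).
pose I := [seq (i%:Z - N%:Z) | i <- iota 0 (N.*2.+1)].
have inI (i : int) : (`|i| <= N)%N -> i \in I.
  move=> le_i; apply/mapP; exists (absz (i + N%:Z)); last by lia.
  by rewrite mem_iota; lia.
exists [seq (x, z) | x <- [seq (x, y) | x <- I, y <- I], z <- I].
case=> [[a b] c] /and3P[a0 c0 /eqP d].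
by apply: allpairs_f; [apply: allpairs_f |]; apply: inI; rewrite /N -d; nia.
Qed.

Lemma iter_ambiguous_form (m : int) (t : form) (k : nat) :
  ambiguous_form m t -> ambiguous_form m (iter k next_form t).
Proof. by move=> Ht; elim: k => //= k; apply: next_ambiguous_form. Qed.

Lemma iter_next_form_sub (m : int) (t : form) (i j : nat) : ambiguous_form m t ->
  (i <= j)%N -> iter i next_form t = iter j next_form t ->
  iter (j - i) next_form t = t.
Proof.
move=> Ht; elim: i j => [|i IH] j le_ij; first by rewrite subn0.
case: j le_ij => // j le_ij; rewrite subSS !iterS => e; apply: IH => //.
rewrite -(next_formK (iter_ambiguous_form i Ht)) e.
exact: next_formK (iter_ambiguous_form j Ht).
Qed.

Lemma next_form_periodic (m : int) (t : form) : ambiguous_form m t ->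
  exists k, (0 < k)%N && (iter k next_form t == t).
Proof.
move=> Ht; have Hi k := iter_ambiguous_form k Ht.
have [L inL] := ambiguous_form_finite m.
have [i [j [lt_ij eq_ij]]] : exists i j, (i < j)%N /\ iter i next_form t = iter j next_form t.
  pose s := mkseq (fun k => iter k next_form t) (size L).+1.
  have : ~~ uniq s.
    apply/negP => /uniq_leq_size le_size.
    have /le_size : {subset s <= L} by move=> _ /mapP[k _ ->]; apply: inL.
    by rewrite size_mkseq ltnn.
  case/(uniqPn t) => i [j [lt_ij lt_js]]; rewrite size_mkseq in lt_js.
  by rewrite !nth_mkseq ?(ltn_trans lt_ij) // => e; exists i, j.
exists (j - i)%N; rewrite subn_gt0 lt_ij /=; apply/eqP.
exact: iter_next_form_sub Ht (ltnW lt_ij) eq_ij.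
Qed.

Lemma pos_amb_form_root (x x' : algC) : pos_amb x x' ->
  exists m t, [/\ 0 < m, ambiguous_form m t & form_root m t = x].
Proof.
move=> [[u [v [ex ex']]] x0 x'0].
pose a := numq u * denq v; pose b := numq v * denq u; pose c := denq u * denq v.
have c0 : 0 < c by rewrite mulr_gt0.
have cn : c%:~R != 0 :> algC by rewrite intr_eq0 lt0r_neq0.
have E (e : algC) : ratr u + e * (ratr v * sqrt3) = (a%:~R + e * (b%:~R * sqrt3)) / c%:~R.
  have := denq_neq0 u; have := denq_neq0 v; rewrite -!(intr_eq0 algC) => dv du.
  by rewrite /ratr !rmorphM /=; field; rewrite dv.
clearbody a b c.
have {}ex : x = (a%:~R + b%:~R * sqrt3) / c%:~R by have := E 1; rewrite !mul1r -ex.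
have {}ex' : x' = (a%:~R - b%:~R * sqrt3) / c%:~R.
  by have := E (-1); rewrite !mulN1r -ex'.
have b0 : 0 < b.
  have : 0 < x - x' by rewrite subr_gt0 (lt_trans x'0).
  have -> : x - x' = b%:~R * (2 * sqrt3 / c%:~R) by rewrite ex ex'; field.
  by rewrite pmulr_lgt0 ?ltr0z // divr_gt0 ?ltr0z // mulr_gt0 ?sqrt3_gt0.
have N0 : a ^+ 2 - 3 * b ^+ 2 < 0.
  have : x * x' < 0 by rewrite pmulr_rlt0.
  have -> : x * x' = (a ^+ 2 - 3 * b ^+ 2)%:~R / c%:~R ^+ 2.
    have -> : (a ^+ 2 - 3 * b ^+ 2)%:~R = a%:~R ^+ 2 - sqrt3 ^+ 2 * b%:~R ^+ 2 :> algC.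
      by rewrite sqrt3_sq rmorphB /= rmorphXn /= rmorphM /= rmorphXn.
    by rewrite ex ex'; field.
  by rewrite pmulr_llt0 ?ltrz0 // invr_gt0 exprn_gt0 ?ltr0z.
(* The form is c^2 times the minimal polynomial of (a + b sqrt 3) / c. *)
exists (2 * b * c), (c ^+ 2, - (2 * a * c), a ^+ 2 - 3 * b ^+ 2); split.
- by rewrite !mulr_gt0.
- by rewrite /ambiguous_form exprn_gt0 // N0 /=; apply/eqP; ring.
by rewrite /form_root ex opprK !(rmorphM, rmorphXn) /=; field.
Qed.

Lemma farey_step_pgl2 (z y : algC) : 0 < z -> farey_step z y -> pgl2 z y.
Proof.
move=> z0; have z1 := lt0r_neq0 (addr_gt0 z0 ltr01).
case=> ->; left; first by exists 1, 1, 0, 1; split=> //; ring.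
by exists 1, 0, 1, 1; split=> //; field.
Qed.

(** The positive members of the circuit are the Farey iterates of x; the C-edge
    from an iterate ends at the image by D of the next one. *)
Lemma pos_circuit (x x' : algC) : pos_amb x x' ->
  exists n beta, circuit n beta /\ forall i, (i < n.*2)%N -> pgl2 x (beta i).
Proof.
move=> /pos_amb_form_root[m [t [m0 Ht <-]]].
pose T k := iter k next_form t; pose X k := form_root m (T k).
have HT k : ambiguous_form m (T k) by apply: iter_ambiguous_form.
have aX k : exists x', pos_amb (X k) x' by apply: form_root_pos_amb.
have X0 k : 0 < X k by have [? []] := aX k.
have Xn k := lt0r_neq0 (X0 k).
have X1 k := lt0r_neq0 (addr_gt0 (X0 k) ltr01).
have stepX k : farey_step (X k) (X k.+1) by apply: form_root_step.
have per := next_form_periodic Ht.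
(* Minimality of the period is what makes the circuit simple. *)
case: (ex_minnP per) => n /andP[n0 /eqP Tn] n_min.
have T_inj i j : (i < n)%N -> (j < n)%N -> T i = T j -> i = j.
  wlog le_ij : i j / (i <= j)%N.
    by move=> H; case: (leqP i j) => [/H|/ltnW/H h lt_i lt_j /esym/h ->].
  move=> lt_i lt_j /(iter_next_form_sub Ht le_ij) e.
  move: le_ij; rewrite leq_eqVlt => /orP[/eqP // | lt_ij].
  have := n_min (j - i)%N; rewrite e eqxx subn_gt0 lt_ij => /(_ isT); lia.
have X_inj i j : X i = X j -> T i = T j by apply: form_root_inj.
have aXa k : ambiguous (X k) by have [? /pos_amb_ambiguous] := aX k.
pose beta i := if odd i then - (X i./2.+1)^-1 else X i./2.
have beta_odd j : beta j.*2.+1 = - (X j.+1)^-1.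
  by rewrite /beta /= odd_double /= uphalf_double.
have beta_even j : beta j.*2 = X j by rewrite /beta odd_double doubleK.
exists n, beta; split; last first.
  have gX k : pgl2 (X 0%N) (X k).
    elim: k => [|k IH]; first exact: pgl2_refl.
    exact: pgl2_trans IH (farey_step_pgl2 (X0 k) (stepX k)).
  move=> i _; rewrite /beta; case: ifP => _; last exact: gX.
  by apply: pgl2_trans (gX _) _; left; apply: gl2NV.
split=> //.
- by move=> i _; rewrite /beta; case: ifP => _ //; apply/ambiguousN/ambiguousV.
(* Even indices carry positive numbers and odd indices negative ones. *)
- have sgn k l : - (X k)^-1 <> X l.
    by move=> e; have := X0 l; rewrite -e oppr_gt0 invr_lt0 lt_gtF.
  move=> i j lt_i lt_j; rewrite /beta.
  have lt_i2 : (i./2 < n)%N by lia.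
  have lt_j2 : (j./2 < n)%N by lia.
  case: ifP => oi; case: ifP => oj.
  + move=> /oppr_inj/invr_inj/X_inj /(congr1 prev_form).
    rewrite /T !iterS !(@next_formK m) //; try exact: HT.
    by move/(T_inj _ _ lt_i2 lt_j2); lia.
  + by move/sgn.
  + by move/esym/sgn.
  by move/X_inj/(T_inj _ _ lt_i2 lt_j2); lia.
- move=> j lt_j; rewrite beta_odd beta_even genCCE // genCE //.
  case: (stepX j) => ->; [right | left] => //.
  by congr Some; field; rewrite Xn X1.
move=> j lt_j; rewrite beta_odd genDE ?oppr_eq0 ?invr_eq0 // invrN invrK opprK.
congr Some; rewrite -doubleS; case: (ltnP j.+1 n) => jn.
  by rewrite modn_small ?beta_even // ltn_double.
have -> : j.+1 = n by lia.
by rewrite modnn /X /T Tn; apply: (beta_even 0%N).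
Qed.

(** * Closed paths *)

Local Open Scope classical_set_scope.

(** The right-hand side depends on the orbit only: this is the uniqueness of the
    closed path. *)
Lemma closed_pathE (alpha : algC) (P : set P1) : ambiguous alpha ->
  closed_path alpha P ->
  P = [set Some x | x in [set x | ambiguous x /\ picard_orbit (Some alpha) (Some x)]].
Proof.
move=> aalpha [P_orbit [n [beta [circ PE]]]].
have amb i : (i < n.*2)%N -> ambiguous (beta i) by case: circ => _ h _ _ _; apply: h.
apply/seteqP; split=> [z Pz|_ [x [ax /(ambiguous_orbitP aalpha ax) gx] <-]].
  have := P_orbit z Pz; move: Pz; rewrite PE => -[] [i lt_i <-] oz.
    by exists (beta i) => //; split=> //; apply: amb.
  move: oz; rewrite genBE; last exact: ambiguous_neq0 (amb i lt_i).
  by move=> oz; exists (beta i)^-1 => //; split=> //; apply/ambiguousV/amb.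
have n0 : (0 < n.*2)%N by case: circ => ?; rewrite double_gt0.
have P0 : P (Some (beta 0)) by rewrite PE; left; exists 0%N.
have /(ambiguous_orbitP aalpha (amb 0%N n0)) g0 := P_orbit _ P0.
have := on_path_full circ ax (pgl2_trans (pgl2_sym g0) gx).
rewrite PE => -[] [i lt_i xE]; [left | right]; exists i => //; first by rewrite xE.
by rewrite genBE ?(ambiguous_neq0 (amb i lt_i)) // -xE invrK.
Qed.

Lemma closed_path_exists (alpha : algC) : ambiguous alpha ->
  exists P, closed_path alpha P.
Proof.
move=> aalpha.
have [x [x' [ax gx]]] : exists x x', pos_amb x x' /\ pgl2 alpha x.
  have [x' [ax|ax]] := ambiguous_pos aalpha.
    by exists alpha, x'; split=> //; apply: pgl2_refl.
  exists (- alpha^-1), x'; split=> //; left; apply: gl2NV.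
  exact: ambiguous_neq0.
have [n [beta [circ gb]]] := pos_circuit ax.
exists ([set Some (beta i) | i in `I_(n.*2)] `|`
        [set genB (Some (beta i)) | i in `I_(n.*2)]).
split; last by exists n, beta.
have amb i : (i < n.*2)%N -> ambiguous (beta i) by case: circ => _ h _ _ _; apply: h.
move=> _ [] [i lt_i <-]; have g := pgl2_trans gx (gb i lt_i).
  by apply/(ambiguous_orbitP aalpha (amb i lt_i)).
have b0 := ambiguous_neq0 (amb i lt_i).
rewrite genBE //; apply/(ambiguous_orbitP aalpha (ambiguousV (amb i lt_i))).
by apply: pgl2_trans g _; right; apply: gl2V.
Qed.

Theorem theorem2 (alpha : algC) (halpha : in_Qi3 alpha)
  (hamb : ambiguous alpha) :
  exists! P : set P1, closed_path alpha P.
Proof.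
have [P HP] := closed_path_exists hamb; exists P; split=> // Q HQ.
by rewrite (closed_pathE hamb HP) (closed_pathE hamb HQ).
Qed.
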